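(* Let $r\ge 2$ and let $F$ be an $r$-graph with at least one edge. Then the limit $$\gamma^+(F)=\lim_{n\to\infty}\frac{\mathrm{co^+ex}(n,F)}{n}$$ exists. Moreover, for every $\varepsilon>0$ there exists an $F$-free $r$-graph $H=H(F,\varepsilon)$ such that every blow-up of $H$ is $F$-free, and for all sufficiently large $n$, $$\frac{\delta_{r-1}^+(H[n/v(H)])}{n}>\gamma^+(F)-\varepsilon .$$
   Context: An $r$-graph is a finite $r$-uniform hypergraph; $v(H)$ is the number of vertices of $H$. The minimum positive co-degree $\delta_{r-1}^+(H)$ of a non-empty $r$-graph $H$ is the maximum $k$ such that every $(r-1)$-set of vertices contained in some edge of $H$ is contained in at least $k$ distinct edges of $H$; by convention it is $0$ if $H$ has no edges. A hypergraph is $F$-free if it has no (not necessarily induced) subhypergraph isomorphic to $F$. $\mathrm{co^+ex}(n,F)$ is the maximum of $\delta_{r-1}^+(H)$ over all $n$-vertex $F$-free $r$-graphs $H$. A blow-up of $H$ is an $r$-graph obtained by replacing each vertex $v_i$ of $H$ by a class $V_i$ of vertices (classes pairwise disjoint), where $r$ vertices form an edge if and only if they lie in $r$ distinct classes corresponding to the $r$ vertices of an edge of $H$. $H[n/v(H)]$ denotes a balanced blow-up of $H$ on $n$ vertices, i.e. one in which every class has size $\lfloor n/v(H)\rfloor$ or $\lceil n/v(H)\rceil$; the choice need not be unique, and the statement holds for any such balanced blow-up. *)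

(* Defs.v *)
From HB Require Import structures.
From mathcomp Require Import all_boot all_order all_algebra.
From mathcomp Require Import all_classical all_reals all_analysis.

Set Implicit Arguments.
Unset Strict Implicit.
Unset Printing Implicit Defensive.

Import Order.TTheory GRing.Theory Num.Theory.
Import numFieldNormedType.Exports.

(* The vertex set is the whole type [V]; vertices may be isolated. *)
Record hypergraph (r : nat) (V : finType) := Hypergraph {
  edges : {set {set V}};
  edges_uniform : [forall e in edges, #|e| == r]
}.

HB.instance Definition _ (r : nat) (V : finType) := [isSub for @edges r V].
HB.instance Definition _ (r : nat) (V : finType) :=
  [Finite of hypergraph r V by <:].

Section Hypergraphs.
Variables (r : nat) (V : finType).
Implicit Types (H : hypergraph r V) (S : {set V}).

Definition codegree H S : nat := #|[set e in edges H | S \subset e]|.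

Definition codegree_bound H (k : nat) : bool :=
  [forall S : {set V},
     (#|S| == r.-1) && [exists e in edges H, S \subset e]
       ==> (k <= codegree H S)%N].

(* The range [k <= #|edges H|] loses no candidate when [H] has an edge (a
   codegree never exceeds the number of edges), and yields the conventional
   value 0 when [H] has none; see [min_pos_codegreeP], [min_pos_codegree0]. *)
Definition min_pos_codegree H : nat :=
  \max_(k < #|edges H|.+1 | codegree_bound H k) k.

(* [phi] identifies [F] with a subhypergraph, not necessarily induced. *)
Definition contains_copy (VF : finType) (F : hypergraph r VF) H : bool :=
  [exists phi : {ffun VF -> V},
     injectiveb phi &&
       ([set phi @: (e : {set VF}) | e in edges F] \subset edges H)].

Definition copy_free (VF : finType) (F : hypergraph r VF) H : bool :=
  ~~ contains_copy F H.

(* A blow-up is given by its vertex set [W] and the map [p] sending each vertex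
   to the vertex of [H] it replaces, so the class of [v] is [p @^-1: [set v]];
   classes may be empty.  Injectivity of [p] on [e] says that the vertices of
   [e] lie in distinct classes. *)
Definition blowup_edges H (W : finType) (p : W -> V) : {set {set W}} :=
  [set e : {set W} | dinjectiveb p e & p @: e \in edges H].

Lemma blowup_uniform H (W : finType) (p : W -> V) :
  [forall e in blowup_edges H p, #|e| == r].
Proof.
apply/forall_inP => e; rewrite inE => /andP[/dinjectiveP inj_p pe].
by rewrite -(card_in_imset inj_p); apply: (forall_inP (edges_uniform H)).
Qed.

Definition blowup H (W : finType) (p : W -> V) : hypergraph r W :=
  Hypergraph (blowup_uniform H p).

Definition ceil_div (n m : nat) : nat := ((n + m.-1) %/ m)%N.

Definition balanced_blowup (W : finType) (p : W -> V) : Prop :=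
  forall v : V, #|p @^-1: [set v]| = (#|W| %/ #|V|)%N
             \/ #|p @^-1: [set v]| = ceil_div #|W| #|V|.

Lemma min_pos_codegree0 H : #|edges H| = 0 -> min_pos_codegree H = 0.
Proof.
move=> H0; rewrite /min_pos_codegree; apply/eqP; rewrite -leqn0.
by apply/bigmax_leqP => -[k /= klt] _; rewrite -ltnS -H0.
Qed.

Lemma min_pos_codegreeP H (k : nat) : (0 < #|edges H|)%N ->
  codegree_bound H k = (k <= min_pos_codegree H)%N.
Proof.
move=> Hgt0.
have dom j i : (j <= i)%N -> codegree_bound H i -> codegree_bound H j.
  move=> ji /forallP hi; apply/forallP => S; apply/implyP => hS.
  exact: leq_trans ji (implyP (hi S) hS).
have bnd j : codegree_bound H j -> (j < #|edges H|.+1)%N.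
  move=> /forallP hj; case/card_gt0P: Hgt0 => e eH.
  have [S Se cS] : exists2 S : {set V}, S \subset e & #|S| = r.-1.
    have /eqP ce := forall_inP (edges_uniform H) e eH.
    case: (set_0Vmem e) => [e0|[x xe]].
      by exists e; rewrite // ce -ce e0 cards0.
    by exists (e :\ x); [exact: finset.subsetDl | rewrite -ce (cardsD1 x e) xe].
  rewrite ltnS; apply: leq_trans (implyP (hj S) _) _.
    by rewrite cS eqxx; apply/exists_inP; exists e.
  by apply: subset_leq_card; apply/fintype.subsetP => e'; rewrite inE => /andP[].
apply/idP/idP => [hk|]; first exact: (bigop.bigmax_sup (Ordinal (bnd k hk))).
move=> /dom; apply; rewrite /min_pos_codegree.
apply: (big_ind (codegree_bound H)) => //.
- by apply/forallP => S; apply/implyP.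
- by move=> i j hi hj; case: (leqP i j).
Qed.

End Hypergraphs.

(* Every property involved is invariant under isomorphism, so the n-vertex
   r-graphs may be taken on the vertex set ['I_n]. *)
Definition coex (r : nat) (VF : finType) (F : hypergraph r VF) (n : nat) : nat :=
  \max_(H : hypergraph r 'I_n | copy_free F H) min_pos_codegree H.

Local Open Scope ring_scope.

Definition coex_ratio (R : realType) (r : nat) (VF : finType)
    (F : hypergraph r VF) : R^nat :=
  fun n => (coex F n)%:R / n%:R.

(* Meaningful only together with the convergence of [coex_ratio]. *)
Definition gamma_plus (R : realType) (r : nat) (VF : finType)
    (F : hypergraph r VF) : R :=
  limn (coex_ratio R F).

(* Main.v *)
Require Import Defs.
From HB Require Import structures.
From mathcomp Require Import all_boot all_order all_algebra.
From mathcomp Require Import all_classical all_reals all_analysis.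
From mathcomp Require Import ring lra.

(* Let [H] be an [F]-free [r]-graph on a large set [X], of positive co-degree
   [d * #|X|], and let [f] be a uniformly random map from a fixed large set
   ['I_m] to [X]; the sample is the pullback of [H] along [f].
   - By Chernoff and a union bound over the [(r-1)]-sets, with high probability
     every positive codegree of the sample is at least [(d - eps) * m].
   - With probability at least [d ^ r] the sample has an edge.
   - All blow-ups of the sample are [F]-free as soon as there is no homomorphism
     from [F] to it.  A homomorphism through a fixed map [VF -> 'I_m] has
     vanishing probability: if the map is injective, freeness of [H] forces a
     collision of [f]; otherwise Cauchy-Schwarz separates two identified
     vertices of [F] at the cost of squaring the probability.
   Hence some [m]-vertex graph all of whose blow-ups are [F]-free has codegree
   ratio at least [d - eps], which gives both the limit and the second claim. *)

Set Implicit Arguments.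
Unset Strict Implicit.
Unset Printing Implicit Defensive.

Import Order.TTheory GRing.Theory Num.Theory.
Import numFieldNormedType.Exports.

Local Open Scope ring_scope.

(** * Codegrees and blow-ups *)

Section Codegrees.
Variables (r : nat) (V : finType) (H : hypergraph r V).
Implicit Types (S T e : {set V}).

Lemma edge_card e : e \in edges H -> #|e| = r.
Proof. by move=> eH; apply/eqP/(forall_inP (edges_uniform H)). Qed.

Definition pos_codegree T : bool :=
  (#|T| == r.-1) && [exists e in edges H, T \subset e].

Definition nbr T : {set V} := [set x | x |: T \in edges H].

Lemma card_nbr T : (0 < r)%N -> #|T| = r.-1 -> codegree H T = #|nbr T|.
Proof.
move=> r0 cT.
have NT x : x \in nbr T -> x \notin T.
  rewrite inE => /edge_card; apply: contra_eqN => xT.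
  by rewrite (finset.setUidPr _) ?finset.sub1set // cT -{2}(prednK r0) eqn_leq ltnn andbF.
have inj : {in nbr T &, injective (fun x => x |: T)}.
  move=> x y xN yN /finset.setP/(_ x); rewrite !inE eqxx /= (negPf (NT _ xN)) orbF.
  by move/esym/eqP.
rewrite -(card_in_imset inj); apply: eq_card => e; rewrite inE.
apply/andP/imsetP => [[eH Te]|[x xN ->]]; last first.
  by move: xN; rewrite inE => ->; rewrite finset.subsetUr.
have setUTe : T :|: (e :\: T) = e.
  by apply/finset.setP => y; rewrite !inE; case: (boolP (y \in T)) => // /(fintype.subsetP Te).
have : #|e :\: T| == 1%N.
  by rewrite cardsD (finset.setIidPr Te) (edge_card eH) cT; rewrite -{1}(prednK r0) subSnn.
case/cards1P => x De; exists x; last by rewrite -De finset.setUC setUTe.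
by rewrite inE -De finset.setUC setUTe.
Qed.

Lemma pos_codegree_sub e x : e \in edges H -> x \in e -> pos_codegree (e :\ x).
Proof.
move=> eH xe; apply/andP; split; last by apply/exists_inP; exists e; rewrite // finset.subsetDl.
by rewrite -(edge_card eH) (cardsD1 x e) xe.
Qed.

Lemma min_pos_codegree_le_nbr T : (0 < r)%N -> pos_codegree T ->
  (min_pos_codegree H <= #|nbr T|)%N.
Proof.
move=> r0 pT; case/andP: (pT) => /eqP cT /exists_inP[e eH Te].
rewrite -card_nbr //.
have H0 : (0 < #|edges H|)%N by apply/card_gt0P; exists e.
have := min_pos_codegreeP (min_pos_codegree H) H0; rewrite leqnn => /forallP/(_ T).
by move/implyP; apply.
Qed.

Lemma min_pos_codegree_le_card : (0 < r)%N -> (min_pos_codegree H <= #|V|)%N.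
Proof.
move=> r0; case: (posnP #|edges H|) => [/min_pos_codegree0 -> //|/card_gt0P[e eH]].
have : (0 < #|e|)%N by rewrite (edge_card eH).
case/card_gt0P => x xe.
exact: leq_trans (min_pos_codegree_le_nbr r0 (pos_codegree_sub eH xe)) (max_card _).
Qed.

(** The edge [e] rules out the edgeless case, where the bound on neighbourhoods holds vacuously but
    [min_pos_codegree] is 0 by convention. *)
Lemma min_pos_codegree_ge k e : (0 < r)%N -> e \in edges H ->
  (forall T, pos_codegree T -> (k <= #|nbr T|)%N) -> (k <= min_pos_codegree H)%N.
Proof.
move=> r0 eH Hk; rewrite -min_pos_codegreeP; last by apply/card_gt0P; exists e.
apply/forallP => T; apply/implyP => pT; rewrite card_nbr //; first exact: Hk.
by case/andP: pT => /eqP.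
Qed.

End Codegrees.

Section Blowup.
Variables (r : nat) (V : finType) (H : hypergraph r V) (W : finType) (p : W -> V).

Lemma blowup_edgesE (e : {set W}) :
  (e \in edges (blowup H p)) = (#|e| == r) && (p @: e \in edges H).
Proof.
rewrite inE; apply/andP/andP => -[H1 H2]; split => //.
  by apply/eqP; rewrite -(card_in_imset (dinjectiveP _ _ H1)) (edge_card H2).
by apply/dinjectiveP/imset_injP; rewrite (edge_card H2) eq_sym.
Qed.

Lemma pos_codegree_blowup (S : {set W}) :
  pos_codegree (blowup H p) S -> pos_codegree H (p @: S).
Proof.
case/andP => /eqP cS /exists_inP[e]; rewrite inE => /andP[/dinjectiveP inj pe] Se.
rewrite /pos_codegree card_in_imset ?cS ?eqxx /=; last first.
  by move=> x y xS yS; apply: inj; apply: (fintype.subsetP Se).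
by apply/exists_inP; exists (p @: e) => //; apply: imsetS.
Qed.

(** [x |: S] has at most [r] elements while its image, an edge of [H], has exactly [r]; hence [p] is
    injective on it. *)
Lemma nbr_blowup (S : {set W}) : (0 < r)%N -> #|S| = r.-1 ->
  p @^-1: nbr H (p @: S) \subset nbr (blowup H p) S.
Proof.
move=> r0 cS; apply/fintype.subsetP => x; rewrite !inE => pe.
have cpe := edge_card pe; move: pe; rewrite -imsetU1 => pe.
have -> := pe; rewrite andbT; apply/dinjectiveP/imset_injP.
have le_r : (#|x |: S| <= r)%N.
  by rewrite cardsU1 cS -{2}(prednK r0) -add1n leq_add2r leq_b1.
rewrite imsetU1 cpe eqn_leq le_r andbT.
by have := leq_imset_card p (x |: S); rewrite imsetU1 cpe.
Qed.

End Blowup.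

Lemma min_pos_codegree_attained (r : nat) (V : finType) (H : hypergraph r V) :
  (0 < r)%N -> (0 < #|edges H|)%N ->
  exists2 T, pos_codegree H T & (#|nbr H T| <= min_pos_codegree H)%N.
Proof.
move=> r0 /card_gt0P[e eH]; apply/exists_inP; rewrite -[X in is_true X]negbK negb_exists_in.
apply/negP => /forall_inP all.
have : (min_pos_codegree H < min_pos_codegree H)%N.
  by apply: (min_pos_codegree_ge r0 eH) => T /all; rewrite -ltnNge.
by rewrite ltnn.
Qed.

(** The neighbourhood of [T] in the blow-up contains the classes of all neighbours of [p @: T] in
    [H], and each class contributes at least [t] vertices. *)
Lemma min_pos_codegree_blowup (r : nat) (V W : finType) (H : hypergraph r V)
    (p : W -> V) (t : nat) : (0 < r)%N ->
    (forall v, (t <= #|p @^-1: [set v]%SET|)%N) ->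
  (t * min_pos_codegree H <= min_pos_codegree (blowup H p))%N.
Proof.
move=> r0 ht; have [->//|t0] := posnP t.
have [/min_pos_codegree0 ->|/card_gt0P[e eH]] := posnP #|edges H|; first by rewrite muln0.
(* No class is empty, so choosing one vertex in each lifts an edge of [H] to the blow-up. *)
have sec v : exists w, p w == v.
  have /card_gt0P[w] := leq_trans t0 (ht v).
  by rewrite !inE => /eqP pw; exists w; rewrite pw.
pose g v := xchoose (sec v).
have gK : cancel g p by move=> v; apply/eqP; exact: (xchooseP (sec v)).
have geH : g @: e \in edges (blowup H p).
  rewrite blowup_edgesE -imset_comp (eq_imset _ gK) imset_id eH.
  by rewrite card_imset ?(edge_card eH) ?eqxx //; apply: can_inj gK.
apply: (min_pos_codegree_ge r0 geH) => T pT.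
have /eqP cT : #|T| == r.-1 by case/andP: pT.
apply: leq_trans (subset_leq_card (nbr_blowup H p r0 cT)).
have -> : #|p @^-1: nbr H (p @: T)| = (\sum_(v in nbr H (p @: T)) #|p @^-1: [set v]%SET|)%N.
  rewrite -sum1_card (partition_big p (mem (nbr H (p @: T)))) /=; last by move=> w; rewrite inE.
  apply: eq_bigr => v vN; rewrite -sum1_card; apply: eq_bigl => w; rewrite !inE.
  by apply: andb_idl => /eqP ->; move: vN; rewrite inE.
apply: (@leq_trans (\sum_(v in nbr H (p @: T)) t)); last by apply: leq_sum.
by rewrite sum_nat_const mulnC leq_mul2r min_pos_codegree_le_nbr ?orbT // pos_codegree_blowup.
Qed.

Lemma empty_uniform (r : nat) (V : finType) :
  [forall e in (finset.set0 : {set {set V}}), #|e| == r].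
Proof. by apply/forall_inP => e; rewrite inE. Qed.

Definition empty_hypergraph (r : nat) (V : finType) : hypergraph r V :=
  Hypergraph (empty_uniform r V).

(** * Means over random maps *)

Section Resampling.
Variables (R : realType) (I X : finType).
Implicit Types (f : {ffun I -> X}) (Phi : {ffun I -> X} -> R).

Definition upd f i x : {ffun I -> X} := [ffun j => if j == i then x else f j].

Definition mean Phi : R := (\sum_f Phi f) / #|{ffun I -> X}|%:R.

Definition pr (A : pred {ffun I -> X}) : R := mean (fun f => (A f)%:R).

(** Exchanging [f i] with the fresh value [x] is an involution on pairs [(f, x)]. This invariance of
    the uniform measure stands in for independence of the coordinates in all later estimates. *)
Lemma mean_upd i Phi :
  mean (fun f => (\sum_x Phi (upd f i x)) / #|X|%:R) = mean Phi.
Proof.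
rewrite /mean; case: (posnP #|X|) => [X0|X0].
  have noX (x : X) : False by have /card0_eq/(_ x) := X0.
  congr (_ / _); apply: eq_bigr => f _; exact: (False_ind _ (noX (f i))).
have Xn0 : #|X|%:R != 0 :> R by rewrite pnatr_eq0 -lt0n.
rewrite -mulr_suml; congr (_ / _); apply: (mulIf Xn0); rewrite mulfVK //.
rewrite pair_bigA /=.
pose sw (q : {ffun I -> X} * X) := (upd q.1 i q.2, q.1 i).
have swK : involutive sw.
  move=> [f x]; congr pair; last by rewrite ffunE eqxx.
  by apply/ffunP => j; rewrite !ffunE /=; case: eqP => // ->.
rewrite (reindex_inj (inv_inj swK)) /=.
transitivity (\sum_(q : {ffun I -> X} * X) Phi q.1).
  by apply: eq_bigr => q _; have /(congr1 fst)/= -> := swK q.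
rewrite -(pair_bigA _ (fun f _ => Phi f)) /= mulr_suml.
by apply: eq_bigr => f _; rewrite sumr_const mulr_natr.
Qed.

Lemma ler_mean Phi Psi : (forall f, Phi f <= Psi f) -> mean Phi <= mean Psi.
Proof. by move=> le; rewrite ler_wpM2r ?invr_ge0 // ler_sum. Qed.

Lemma mean_sum (K : finType) (P : pred K) (Phi : K -> {ffun I -> X} -> R) :
  mean (fun f => \sum_(k | P k) Phi k f) = \sum_(k | P k) mean (Phi k).
Proof. by rewrite /mean exchange_big /= mulr_suml. Qed.

Lemma pr_union (K : finType) (P : pred K) (A : pred {ffun I -> X})
    (B : K -> pred {ffun I -> X}) :
  (forall f, A f -> exists2 k, P k & B k f) -> pr A <= \sum_(k | P k) pr (B k).
Proof.
move=> AB; rewrite /pr -mean_sum; apply: ler_mean => f.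
case: (boolP (A f)) => [/AB[k Pk Bk]|_]; last by rewrite sumr_ge0.
by rewrite (bigD1 k) //= Bk lerDl sumr_ge0.
Qed.

Lemma meanZ c Phi : mean (fun f => c * Phi f) = c * mean Phi.
Proof. by rewrite /mean -mulr_sumr mulrA. Qed.

Lemma meanD Phi Psi : mean (fun f => Phi f + Psi f) = mean Phi + mean Psi.
Proof. by rewrite /mean big_split mulrDl. Qed.

Lemma eq_mean Phi Psi : Phi =1 Psi -> mean Phi = mean Psi.
Proof. by move=> eqP; rewrite /mean (eq_bigr _ (fun f _ => eqP f)). Qed.

Lemma pr_ge0 A : 0 <= pr A.
Proof. by rewrite /pr /mean divr_ge0 // sumr_ge0. Qed.

Hypothesis X0 : (0 < #|X|)%N.

Lemma ffun_card_gt0 : 0 < #|{ffun I -> X}|%:R :> R.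
Proof. by rewrite ltr0n card_ffun expn_gt0 X0. Qed.

Lemma mean_cst c : mean (fun=> c) = c.
Proof.
by rewrite /mean sumr_const -[X in X / _]mulr_natr mulfK // gt_eqF // ffun_card_gt0.
Qed.

Lemma pr_le1 A : pr A <= 1.
Proof. by rewrite -(mean_cst 1) ler_mean // => f; rewrite lern1 leq_b1. Qed.

(** This is nonnegativity of the variance. *)
Lemma sqr_mean_le Phi : mean Phi ^+ 2 <= mean (fun f => Phi f ^+ 2).
Proof.
have : 0 <= mean (fun f => (Phi f - mean Phi) ^+ 2).
  by rewrite -(mean_cst 0) ler_mean // => f; rewrite sqr_ge0.
rewrite (@eq_mean _ (fun f => Phi f ^+ 2 + ((- 2 * mean Phi) * Phi f + mean Phi ^+ 2))); last first.
  by move=> f; ring.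
rewrite meanD meanD meanZ mean_cst; lra.
Qed.

Lemma pr_eq_coord i j : i != j -> pr (fun f => f i == f j) = #|X|%:R^-1.
Proof.
move=> ij; have ji : (j == i) = false by rewrite eq_sym (negPf ij).
rewrite /pr -(mean_upd i) -[RHS]mean_cst; apply: eq_mean => f.
rewrite (bigD1 (f j)) //= big1 ?addr0; first by rewrite !ffunE eqxx ji eqxx mul1r.
by move=> x /negPf xf; rewrite !ffunE eqxx ji xf.
Qed.

(* Cauchy-Schwarz in the coordinate [i]; the second sample of that coordinate
   is stored at [c]. *)
Lemma pr_split (A B : pred {ffun I -> X}) i c :
  (forall f x y, A (upd f i x) -> A (upd f i y) -> B (upd (upd f i x) c y)) ->
  pr A ^+ 2 <= pr B.
Proof.
move=> AB; rewrite /pr -(mean_upd i); apply: (le_trans (sqr_mean_le _)).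
rewrite -[leRHS](mean_upd c) -[leRHS](mean_upd i) ler_mean // => f.
rewrite expr2 mulrAC mulr_suml ler_wpM2r ?invr_ge0 // ler_sum // => x _.
rewrite mulrA mulr_sumr ler_wpM2r ?invr_ge0 // ler_sum // => y _.
rewrite -natrM mulnb ler_nat.
by case: (boolP (_ && _)) => // /andP[/AB/[apply] ->].
Qed.
End Resampling.

(** * Homomorphisms *)

Section Homomorphisms.
Variables (r : nat) (VF V : finType) (F : hypergraph r VF) (H : hypergraph r V).

(* By uniformity such a map is automatically injective on each edge. *)
Definition is_hom (phi : VF -> V) : bool :=
  [forall e in edges F, phi @: (e : {set VF}) \in edges H].

Lemma is_hom_inj phi (e : {set VF}) : is_hom phi -> e \in edges F -> {in e &, injective phi}.
Proof.
move=> /forall_inP hom eF; apply/imset_injP.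
by rewrite (edge_card (hom e eF)) (edge_card eF).
Qed.

Lemma copy_free_hom_inj phi : copy_free F H -> is_hom phi -> injective phi -> False.
Proof.
move=> /negP free /forall_inP hom inj; apply: free; apply/existsP.
exists [ffun x => phi x]; apply/andP; split.
  by apply/injectiveP => x y; rewrite !ffunE => /inj.
apply/fintype.subsetP => _ /imsetP[e eF ->].
by rewrite (eq_imset _ (ffunE _)) hom.
Qed.

(** A copy of [F] in a blow-up, followed by the projection [p], is a homomorphism to [H]. *)
Lemma no_hom_blowup_free : (forall phi : {ffun VF -> V}, ~~ is_hom phi) ->
  forall (W : finType) (p : W -> V), copy_free F (blowup H p).
Proof.
move=> nohom W p; apply/existsP => -[phi /andP[_ sub]].
case/negP: (nohom [ffun x => p (phi x)]); apply/forall_inP => e eF.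
have := fintype.subsetP sub _ (imset_f (fun e : {set VF} => phi @: e) eF).
rewrite blowup_edgesE => /andP[_]; rewrite -imset_comp.
by rewrite (eq_imset _ (ffunE _)).
Qed.

Lemma no_hom_copy_free : (forall phi : {ffun VF -> V}, ~~ is_hom phi) -> copy_free F H.
Proof.
move=> nohom; apply/existsP => -[phi /andP[_ sub]]; case/negP: (nohom phi).
by apply/forall_inP => e eF; apply: (fintype.subsetP sub); apply: imset_f.
Qed.

End Homomorphisms.

Lemma no_hom_empty (r : nat) (VF V : finType) (F : hypergraph r VF) phi :
  (0 < #|edges F|)%N -> ~~ is_hom F (empty_hypergraph r V) phi.
Proof.
by case/card_gt0P => e eF; apply/forall_inP => /(_ e eF); rewrite inE.
Qed.

Lemma is_hom_blowup (r : nat) (VF V W : finType) (F : hypergraph r VF)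
    (H : hypergraph r V) (p : W -> V) (phi : VF -> W) :
  is_hom F (blowup H p) phi -> is_hom F H (p \o phi).
Proof.
move=> /forall_inP hom; apply/forall_inP => e eF.
by have := hom e eF; rewrite blowup_edgesE -imset_comp => /andP[].
Qed.

Section HomDensity.
Variables (R : realType) (r : nat) (VF X I : finType).
Variables (F : hypergraph r VF) (H : hypergraph r X).
Hypotheses (X0 : (0 < #|X|)%N) (FH : copy_free F H).

(** An edge of [F] avoiding [a] has the same image as under the [x] map. In an edge through [a], no
    other vertex shares the value [phi a], since homomorphisms are injective on edges; its image is
    that under the [y] map. *)
Lemma is_hom_split (phi : {ffun VF -> I}) a b c (f : {ffun I -> X}) x y :
    a != b -> phi a = phi b -> c \notin phi @: [set: VF]%SET ->
    is_hom F H (upd f (phi a) x \o phi) -> is_hom F H (upd f (phi a) y \o phi) ->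
  is_hom F H (upd (upd f (phi a) x) c y \o upd phi a c).
Proof.
move=> ab phiab cphi homx homy; apply/forall_inP => e eF.
have phic v : (phi v == c) = false.
  by apply: contraNF cphi => /eqP <-; apply: imset_f.
have [ae|ae] := boolP (a \in e); last first.
  rewrite (_ : _ @: _ = (upd f (phi a) x \o phi) @: e); first exact: (forall_inP homx).
  apply: eq_in_imset => v ve; rewrite /= !ffunE.
  have /negPf-> : v != a by apply: contraNneq ae => <-.
  by rewrite phic.
rewrite (_ : _ @: _ = (upd f (phi a) y \o phi) @: e); first exact: (forall_inP homy).
apply: eq_in_imset => v ve; rewrite /= !ffunE; have [->|va] := eqVneq v a.
  by rewrite !eqxx.
rewrite phic; have [phiva|//] := eqVneq (phi v) (phi a).
case/eqP: va; apply: (is_hom_inj homx eF) => //=.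
by rewrite !ffunE phiva.
Qed.

Lemma pr_hom_inj (phi : {ffun VF -> I}) : injective phi ->
  pr R (fun f => is_hom F H (f \o phi)) <= (#|VF| ^ 2)%:R / #|X|%:R.
Proof.
move=> inj; pose P (q : VF * VF) := q.1 != q.2.
apply: (@le_trans _ _ (\sum_(q | P q) pr R (fun f => f (phi q.1) == f (phi q.2)))).
  apply: pr_union => f hom.
  have /injectivePn[a [b ab fab]] : ~~ injectiveb (f \o phi).
    by apply/injectiveP; apply: copy_free_hom_inj hom.
  by exists (a, b) => //=; apply/eqP.
rewrite (eq_bigr (fun=> #|X|%:R^-1)); last first.
  move=> [a b] /= ab; apply: pr_eq_coord => //.
  by apply: contraNneq ab => /inj ->.
rewrite (sumr_const P) -[leLHS]mulr_natl ler_wpM2r ?invr_ge0 // ler_nat.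
by rewrite (leq_trans (max_card _)) // card_prod mulnn.
Qed.

(** Induction on a bound [k] for the number of vertices missing from the image. Moving [a] to a
    fresh point [c], available because the image is smaller than [I], enlarges the image by one and
    squares the probability; at most [#|VF|] such moves are needed. *)
Lemma pr_hom_le (phi : {ffun VF -> I}) : (#|VF| <= #|I|)%N ->
  pr R (fun f => is_hom F H (f \o phi)) ^+ (2 ^ #|VF|) <= (#|VF| ^ 2)%:R / #|X|%:R.
Proof.
move=> VFI; suff gen k (psi : {ffun VF -> I}) :
    (#|VF| <= #|psi @: [set: VF]%SET| + k)%N ->
    pr R (fun f => is_hom F H (f \o psi)) ^+ (2 ^ k) <= (#|VF| ^ 2)%:R / #|X|%:R.
  by apply: gen; rewrite leq_addl.
elim: k psi => {phi} [|k IH] phi.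
  rewrite addn0 => le; rewrite expn0 expr1; apply: pr_hom_inj.
  have /imset_injP inj : #|phi @: [set: VF]%SET| == #|[set: VF]%SET|.
    by rewrite eqn_leq leq_imset_card cardsT.
  by move=> x y; apply: inj; rewrite finset.in_setT.
case: (boolP (injectiveb phi)) => [/injectiveP inj _|/injectivePn[a [b ab phiab]] le].
  apply: le_trans (pr_hom_inj inj).
  rewrite -[leRHS]expr1 ler_wiXn2l ?pr_ge0 ?pr_le1 //; last by rewrite expn_gt0.
have lt : (#|phi @: [set: VF]%SET| < #|I|)%N.
  apply: leq_trans VFI; rewrite ltn_neqAle -cardsT leq_imset_card andbT.
  apply: contraNneq ab => /eqP/imset_injP inj; apply/eqP.
  by apply: inj => //; rewrite finset.in_setT.
have [c cphi] : exists c, c \notin phi @: [set: VF]%SET.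
  apply/existsP; rewrite -negb_forall; apply: contraL lt => /forallP all.
  by rewrite -leqNgt -cardsT subset_leq_card //; apply/fintype.subsetP => c _.
rewrite expnS exprM.
apply: le_trans (IH (upd phi a c) _); last first.
  apply: leq_trans le _; rewrite -addSnnS leq_add2r.
  have -> : (#|phi @: [set: VF]%SET|).+1 = #|c |: phi @: [set: VF]%SET| by rewrite cardsU1 cphi.
  apply: subset_leq_card; apply/fintype.subsetP => _ /setU1P[->|/imsetP[v _ ->]].
    by apply/imsetP; exists a; rewrite ?ffunE ?eqxx.
  have [->|va] := eqVneq v a.
    by rewrite phiab; apply/imsetP; exists b; rewrite // ffunE eq_sym (negPf ab).
  by apply/imsetP; exists v; rewrite // ffunE (negPf va).
rewrite lerXn2r ?nnegrE ?exprn_ge0 ?pr_ge0 //.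
apply: (@pr_split _ _ _ X0 _ _ (phi a) c) => f x y; exact: is_hom_split ab phiab cphi.
Qed.
End HomDensity.

(** * Codegrees of a random sample *)

(** Enumerate both sets and match them by index, sending the surplus of [J] to the default element
    [x0] of [e]. *)
Lemma imset_onto (I X : finType) (J : {set I}) (e : {set X}) :
  (#|e| <= #|J|)%N -> (0 < #|e|)%N -> exists g : I -> X, g @: J = e.
Proof.
move=> le /card_gt0P[x0 x0e].
exists (fun j => nth x0 (enum e) (index j (enum J))); apply/finset.setP => x.
apply/imsetP/idP => [[j jJ ->]|xe].
  have [lt|ge] := ltnP (index j (enum J)) (size (enum e)).
    by rewrite -mem_enum mem_nth.
  by rewrite nth_default.
have lt : (index x (enum e) < size (enum J))%N.
  by rewrite -cardE (leq_trans _ le) // cardE index_mem mem_enum.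
have [j0 _] : exists j, j \in J by apply/card_gt0P; rewrite cardE; exact: leq_ltn_trans lt.
exists (nth j0 (enum J) (index x (enum e))); first by rewrite -mem_enum mem_nth.
by rewrite index_uniq ?enum_uniq // nth_index // mem_enum.
Qed.

Section Sampling.
Variables (R : realType) (r : nat) (X I : finType) (H : hypergraph r X).
Hypotheses (r0 : (0 < r)%N) (H0 : (0 < #|edges H|)%N).

Let n : R := #|X|%:R.
Let d : R := (min_pos_codegree H)%:R / n.

Lemma edges_vertices : (0 < #|X|)%N.
Proof.
case/card_gt0P: H0 => e eH; apply: leq_trans (max_card (mem e)).
by rewrite (edge_card eH).
Qed.

Let X0 := edges_vertices.

(** Start from a fixed map of [J] onto an edge and randomise its coordinates one by one. While the
    image is an edge, the other [r.-1] images form a set of positive codegree, so the new value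
    keeps it an edge with probability at least [d]. *)
Lemma pr_edge (J : {set I}) : #|J| = r ->
  d ^+ r <= pr R (fun f => J \in edges (blowup H f)).
Proof.
move=> cJ; case/card_gt0P: (H0) => e0 e0H.
have ce0 := edge_card e0H.
have [|//|g0 g0J] := @imset_onto _ _ J e0; rewrite ?ce0 ?cJ //.
(* [mix K f] is random on [K] and frozen to [g0] elsewhere. *)
pose mix (K : {set I}) (f : {ffun I -> X}) i := if i \in K then f i else g0 i.
suff gen k (K : {set I}) : #|K| = k -> K \subset J ->
    d ^+ k <= pr R (fun f => mix K f @: J \in edges H).
  have := gen r J cJ (fintype.subxx _); congr (_ <= _); apply: eq_mean => f.
  rewrite blowup_edgesE cJ eqxx /= (_ : f @: J = mix J f @: J) //.
  by apply: eq_in_imset => i iJ; rewrite /mix iJ.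
elim: k K => [|k IH] K cK KJ.
  rewrite expr0 -(@mean_cst R I X X0 1) ler_mean // => f.
  rewrite (_ : mix K f @: J = e0) ?e0H // -g0J.
  by apply: eq_imset => i; rewrite /mix (cards0_eq cK) finset.in_set0.
have /card_gt0P[i iK] : (0 < #|K|)%N by rewrite cK.
have iJ := fintype.subsetP KJ i iK.
have cK' : #|K :\ i| = k by apply: succn_inj; rewrite -cK (cardsD1 i K) iK.
have := IH _ cK' (fintype.subset_trans (finset.subsetDl _ _) KJ).
rewrite exprS => /(ler_wpM2l (x := d)) le; apply: le_trans (le _) _.
  by rewrite divr_ge0.
rewrite -meanZ -[leRHS](mean_upd i) ler_mean // => f.
rewrite mulrAC ler_wpM2r ?invr_ge0 //.
have [eH|_] := boolP (mix (K :\ i) f @: J \in edges H); last by rewrite mulr0 sumr_ge0.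
rewrite mulr1 -natr_sum ler_nat -big_mkcond /= sum1_card.
have mixE x : mix K (upd f i x) @: J = x |: mix (K :\ i) f @: (J :\ i).
  rewrite -[in LHS](finset.setD1K iJ) imsetU1; congr (_ |: _).
    by rewrite /mix iK ffunE eqxx.
  apply: eq_in_imset => j; rewrite !inE => /andP[/negPf ji _].
  by rewrite /mix !inE ji /= ffunE ji.
have cT : #|mix (K :\ i) f @: (J :\ i)| = r.-1.
  have /imset_injP inj : #|mix (K :\ i) f @: J| == #|J| by rewrite (edge_card eH) cJ.
  rewrite card_in_imset ?(cardsD1 i J) ?iJ //.
    by rewrite -cJ (cardsD1 i J) iJ.
  by move=> x y; rewrite !inE => /andP[_ xJ] /andP[_ yJ]; apply: inj.
have pT : pos_codegree H (mix (K :\ i) f @: (J :\ i)).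
  rewrite /pos_codegree cT eqxx; apply/exists_inP; exists (mix (K :\ i) f @: J) => //.
  exact: imsetS (finset.subsetDl _ _).
apply: leq_trans (min_pos_codegree_le_nbr r0 pT) _.
by apply: subset_leq_card; apply/fintype.subsetP => x; rewrite inE -mixE.
Qed.

Lemma min_pos_codegree_ratio_le1 : d <= 1.
Proof.
rewrite ler_pdivrMr ?mul1r ?ltr0n // ler_nat; exact: min_pos_codegree_le_card.
Qed.

(* Chernoff's bound: the exponential moment of the codegree of [S] is computed
   by resampling one coordinate outside [S] at a time. *)
Lemma exp_moment (S K : {set I}) (w : R) : 0 <= w <= 1 -> [disjoint K & S] ->
  mean (fun f : {ffun I -> X} => (pos_codegree H (f @: S))%:R *
      \prod_(j in K) (if f j \in nbr H (f @: S) then w else 1))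
    <= (1 - d * (1 - w)) ^+ #|K|.
Proof.
move=> /andP[w0 w1]; move ck : #|K| => k; elim: k K ck => [|k IH] K cK dK.
  rewrite expr0 -[leRHS](@mean_cst R I X X0 1) ler_mean // => f.
  by rewrite (cards0_eq cK) big_set0 mulr1 lern1 leq_b1.
have /card_gt0P[i iK] : (0 < #|K|)%N by rewrite cK.
have cK' : #|K :\ i| = k by apply: succn_inj; rewrite -cK (cardsD1 i K) iK.
have dK' : [disjoint K :\ i & S].
  by apply: disjointWl dK; apply: finset.subsetDl.
have iS : i \notin S by rewrite (disjointFr dK iK).
have q0 : 0 <= 1 - d * (1 - w).
  by rewrite subr_ge0 mulr_ile1 ?divr_ge0 ?min_pos_codegree_ratio_le1 ?subr_ge0 ?gerBl.
rewrite exprS; apply: le_trans (ler_wpM2l q0 (IH _ cK' dK')).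
rewrite -meanZ -[leLHS](mean_upd i) ler_mean // => f.
have updS x : upd f i x @: S = f @: S.
  apply: eq_in_imset => j jS; rewrite ffunE; case: eqP => // ji.
  by rewrite -ji jS in iS.
pose g x : R := if x \in nbr H (f @: S) then w else 1.
have -> : \sum_x (pos_codegree H (upd f i x @: S))%:R *
    (\prod_(j in K) if upd f i x j \in nbr H (upd f i x @: S) then w else 1)
  = (\sum_x g x) * ((pos_codegree H (f @: S))%:R * \prod_(j in K :\ i) g (f j)).
  rewrite mulr_suml; apply: eq_bigr => x _.
  rewrite updS (bigD1 i) //= ffunE eqxx mulrCA; congr (_ * (_ * _)).
  apply: eq_big => [j|j /andP[jK /negPf ji]]; first by rewrite !inE andbC.
  by rewrite ffunE ji.
have [pT|_] := boolP (pos_codegree H (f @: S)); last by rewrite !(mul0r, mulr0).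
rewrite !mul1r mulrAC ler_wpM2r ?prodr_ge0 //.
  by move=> j _; rewrite /g; case: ifP.
(* Each neighbour lowers the sum by [1 - w], and there are at least [d * n] of them: this yields one
   factor [1 - d * (1 - w)]. *)
have -> : \sum_x g x = n - #|nbr H (f @: S)|%:R * (1 - w).
  rewrite (bigID (mem (nbr H (f @: S)))) /= (eq_bigr (fun=> w)); last first.
    by move=> x xN; rewrite /g xN.
  rewrite [X in _ + X](eq_bigr (fun=> 1)); last by move=> x /negPf xN; rewrite /g xN.
  rewrite sumr_const (eq_bigl (mem (~: nbr H (f @: S)))); last by move=> x; rewrite !inE.
  rewrite sumr_const -[w *+ _]mulr_natl /n -(cardsC (nbr H (f @: S))) natrD; ring.
rewrite ler_pdivrMr ?ltr0n // mulrBl mul1r lerB // /d mulrAC mulfVK; last first.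
  by rewrite pnatr_eq0 -lt0n.
by rewrite ler_wpM2r ?subr_ge0 // ler_nat min_pos_codegree_le_nbr.
Qed.
End Sampling.

(** Markov's inequality applied to the exponential moment over the coordinates outside [S]; the term
    [r%:R] pays for the [r.-1] coordinates in [S]. *)
Lemma pr_low_codegree (R : realType) (r : nat) (X I : finType)
    (H : hypergraph r X) (S : {set I}) (eps : R) :
    (0 < r)%N -> (0 < #|edges H|)%N -> #|S| = r.-1 -> 0 < eps <= 1 ->
  pr R (fun f : {ffun I -> X} => pos_codegree (blowup H f) S &&
      ((#|nbr (blowup H f) S|)%:R
        < ((min_pos_codegree H)%:R / #|X|%:R - eps) * #|I|%:R))
    <= expR (r%:R - eps ^+ 2 / 4 * #|I|%:R).
Proof.
move=> r0 H0 cS /andP[e0 e1]; set d := _ / _.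
have d0 : 0 <= d by rewrite divr_ge0.
have d1 : d <= 1 := min_pos_codegree_ratio_le1 R r0 H0.
(* The exponent will contain [- (s * eps - s ^+ 2) * #|I|%:R]; [s = eps / 2] is optimal and gives
   the rate [eps ^+ 2 / 4]. *)
pose s := eps / 2; pose w := expR (- s).
have w0 : 0 < w by apply: expR_gt0.
(* From [w * (1 + s) <= 1] one gets [1 - w >= s / (1 + s)], which is at least [s * (1 - s)]. *)
have ws : 1 - w >= s - s ^+ 2.
  have s0 : 0 < s by rewrite divr_gt0.
  have s1 : 1 + s <= expR s := expR_ge1Dx s.
  have we : w * expR s = 1 by rewrite /w -expRD addNr expR0.
  have : w * (1 + s) <= 1 by rewrite -[leRHS]we ler_wpM2l // ltW.
  nra.
have w1 : w <= 1 by rewrite /w -expR0 ler_expR oppr_le0 divr_ge0 // ltW.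
have dis : [disjoint ~: S & S] by rewrite finset.disjoints_subset fintype.subxx.
have := @exp_moment R r X I H r0 H0 S (~: S) w; rewrite (ltW w0) w1 => /(_ isT dis).
set M := mean _ => hM.
apply: (@le_trans _ _ (expR (s * ((d - eps) * #|I|%:R)) * M)).
  rewrite -meanZ; apply: ler_mean => f.
  have [/andP[pS lt]|_] := boolP (_ && _); last first.
    rewrite mulr_ge0 ?expR_ge0 // mulr_ge0 ?prodr_ge0 // => j _.
    by case: ifP => // _; exact: ltW.
  rewrite (pos_codegree_blowup pS) mul1r -big_mkcondr prodr_const /w -expRM_natr -expRD.
  rewrite -[leLHS]expR0 ler_expR mulNr -mulrBr mulr_ge0 //; first by rewrite divr_ge0 // ltW.
  rewrite subr_ge0; apply: le_trans (ltW lt); rewrite ler_nat.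
  apply: leq_trans (subset_leq_card (nbr_blowup H f r0 cS)).
  by apply: subset_leq_card; apply/fintype.subsetP => j; rewrite unfold_in !inE => /andP[].
apply: (@le_trans _ _ (expR (s * ((d - eps) * #|I|%:R)) * expR (- (d * (1 - w)) * #|~: S|%:R))).
  rewrite ler_wpM2l ?expR_ge0 // expRM_natr; apply: le_trans hM _.
  by rewrite lerXn2r ?nnegrE ?expR_ge0 // ?expR_ge1Dx // subr_ge0 mulr_ile1 ?subr_ge0 ?gerBl // ltW.
rewrite -expRD ler_expR.
have -> : #|~: S|%:R = #|I|%:R - r.-1%:R :> R by rewrite -(cardsC S) cS natrD addrAC subrr add0r.
have rr : r.-1%:R <= r%:R :> R by rewrite ler_nat leq_pred.
have r1 : 0 <= r.-1%:R :> R by [].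
have i0 : 0 <= #|I|%:R :> R by [].
set i := #|I|%:R in i0 *; set q := r.-1%:R in r1 rr *.
have A1 : d * (s - s ^+ 2) * i <= d * (1 - w) * i by rewrite ler_wpM2r // ler_wpM2l.
have A2 : d * (1 - w) * q <= q by rewrite ler_piMl // mulr_ile1 ?subr_ge0 ?gerBl // ltW.
have A3 : d * (s ^+ 2 * i) <= s ^+ 2 * i by rewrite ler_piMl // mulr_ge0 // sqr_ge0.
have -> : eps ^+ 2 / 4 * i = s * eps * i - s ^+ 2 * i by rewrite /s; field.
lra.
Qed.

(** * Existence of a good sample *)

Lemma expn_expR_small (R : realType) (r : nat) (c eta : R) : (0 < r)%N -> 0 < c -> 0 < eta ->
  exists m0, forall m, (m0 <= m)%N -> (m ^ r.-1)%:R * expR (r%:R - c * m%:R) <= eta.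
Proof.
(* Bounding [expR (c * m%:R)] below by [(c * m%:R / r%:R) ^+ r] leaves exactly [b * eta / m%:R], so
   [m >= b] suffices. *)
move=> r0 c0 eta0; pose b := expR r%:R * (r%:R / c) ^+ r / eta.
have rR : 0 < r%:R :> R by rewrite ltr0n.
have b0 : 0 < b by rewrite !(mulr_gt0, exprn_gt0, invr_gt0, expR_gt0).
exists (Num.Def.archi_bound b) => m m0.
have bm : b <= m%:R.
  by apply: le_trans (ltW (archi_boundP (ltW b0))) _; rewrite ler_nat.
have mR : 0 < m%:R :> R := lt_le_trans b0 bm.
pose y := c * m%:R / r%:R.
have y0 : 0 < y by rewrite !mulr_gt0 ?invr_gt0.
have yE : y ^+ r <= expR (c * m%:R).
  have -> : c * m%:R = y * r%:R by rewrite mulfVK // gt_eqF.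
  rewrite expRM_natr lerXn2r ?nnegrE ?expR_ge0 ?(ltW y0) //.
  by apply: le_trans (expR_ge1Dx y); rewrite lerDr.
rewrite expRD expRN; apply: (@le_trans _ _ ((m ^ r.-1)%:R * (expR r%:R / y ^+ r))).
  rewrite ler_wpM2l // ler_wpM2l ?expR_ge0 // lef_pV2 ?posrE ?exprn_gt0 ?expR_gt0 //.
have -> : (m ^ r.-1)%:R * (expR r%:R / y ^+ r) = b * eta / m%:R.
  rewrite /b mulfVK ?gt_eqF // /y !expr_div_n exprMn natrX -[in m%:R ^+ r](prednK r0) exprS.
  have mn := lt0r_neq0 mR; have rn := lt0r_neq0 rR; have cn := lt0r_neq0 c0.
  have mp := expf_neq0 r.-1 mn; have rp := expf_neq0 r rn; have cp := expf_neq0 r cn.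
  by field; rewrite mn rp cp mp.
by rewrite ler_pdivrMr // mulrC ler_wpM2l // ltW.
Qed.

Lemma bin_le_expn m k : ('C(m, k) <= m ^ k)%N.
Proof.
apply: leq_trans (leq_pmulr _ (fact_gt0 k)) _; rewrite bin_ffact ffact_prod.
rewrite -[k in leqRHS]card_ord -prod_nat_const; apply: leq_prod => i _.
exact: leq_subr.
Qed.

(** The sample has an edge with probability at least [eps ^+ r], and each of the two bad events has
    probability at most a third of that. The size [m] is fixed before [n0], because the union bound
    over maps [VF -> 'I_m] needs [#|X|] large in terms of [m]. *)
Lemma exists_hom_free_sample (R : realType) (r : nat) (VF : finType)
    (F : hypergraph r VF) (eps : R) :
    (0 < r)%N -> (0 < #|edges F|)%N -> 0 < eps <= 1 ->
  exists m0, forall m, (m0 <= m)%N -> exists n0, forall (X : finType) (H : hypergraph r X),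
    (n0 <= #|X|)%N -> copy_free F H ->
  exists G : hypergraph r 'I_m, (forall phi : {ffun VF -> 'I_m}, ~~ is_hom F G phi) /\
    (min_pos_codegree H)%:R / #|X|%:R - eps <= (min_pos_codegree G)%:R / m%:R.
Proof.
move=> r0 F0 eps01; have /andP[e0 e1] := eps01.
have er0 : 0 < eps ^+ r by rewrite exprn_gt0.
have c0 : 0 < eps ^+ 2 / 4 by rewrite divr_gt0 // exprn_gt0.
have eta0 : 0 < eps ^+ r / 3 by rewrite divr_gt0.
have [m1 hm1] := expn_expR_small r0 c0 eta0.
exists (maxn m1 (maxn r #|VF|)) => m; rewrite !geq_max => /and3P[/hm1 {}hm1 rm km].
pose M := #|{ffun VF -> 'I_m}|.
(* Probability allowed to each of the [M] maps; dividing by [M.+1] makes the total strictly below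
   [eps ^+ r / 3]. *)
pose z : R := eps ^+ r / 3 / M.+1%:R.
have z0 : 0 < z by rewrite divr_gt0.
(* [#|X| > b] makes the bound of [pr_hom_le] smaller than [z ^+ (2 ^ #|VF|)]. *)
pose b : R := (#|VF| ^ 2)%:R / z ^+ (2 ^ #|VF|).
have b0 : 0 <= b by rewrite divr_ge0 // exprn_ge0 // ltW.
exists (Num.Def.archi_bound b) => X H n0 FH.
have bX : b < #|X|%:R.
  by apply: lt_le_trans (archi_boundP b0) _; rewrite ler_nat.
have X0 : (0 < #|X|)%N by rewrite -(ltr0n R); exact: le_lt_trans b0 bX.
set d := _%:R / #|X|%:R.
(* If [d <= eps] the required ratio is nonpositive and the edgeless graph serves; otherwise [d ^+ r]
   dominates [eps ^+ r]. *)
have [de|ed] := leP d eps.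
  exists (empty_hypergraph r 'I_m); split; first by move=> phi; apply: no_hom_empty.
  by apply: (@le_trans _ _ 0); rewrite ?subr_le0 // divr_ge0.
have H0 : (0 < #|edges H|)%N.
  rewrite lt0n; apply/eqP => /min_pos_codegree0 dH.
  by move: ed; rewrite /d dH mul0r ltNge ltW.
pose J : {set 'I_m} := [set widen_ord rm i | i : 'I_r]%SET.
have cJ : #|J| = r.
  by rewrite card_imset ?card_ord // => i j /(congr1 val)/= /val_inj.
pose low (S : {set 'I_m}) (f : {ffun 'I_m -> X}) := pos_codegree (blowup H f) S &&
  ((#|nbr (blowup H f) S|)%:R < (d - eps) * #|'I_m|%:R).
pose B1 (f : {ffun 'I_m -> X}) := [exists S : {set 'I_m}, (#|S| == r.-1) && low S f].
pose B2 (f : {ffun 'I_m -> X}) := [exists phi : {ffun VF -> 'I_m}, is_hom F H (f \o phi)].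
have prB1 : pr R B1 <= eps ^+ r / 3.
  apply: (@le_trans _ _ (\sum_(S : {set 'I_m} | #|S| == r.-1) pr R (low S))).
    by apply: pr_union => f /existsP[S /andP[cS lS]]; exists S.
  apply: (@le_trans _ _ (\sum_(S in [set S : {set 'I_m} | #|S| == r.-1]%SET)
      expR (r%:R - eps ^+ 2 / 4 * m%:R))).
    rewrite big_set /= ler_sum // => S /eqP cS.
    by apply: le_trans (pr_low_codegree r0 H0 cS eps01) _; rewrite card_ord.
  rewrite sumr_const card_draws card_ord -[leLHS]mulr_natl.
  apply: le_trans hm1; rewrite ler_wpM2r ?expR_ge0 // ler_nat; exact: bin_le_expn.
have prB2 : pr R B2 < eps ^+ r / 3.
  apply: (@le_lt_trans _ _ (\sum_(phi : {ffun VF -> 'I_m})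
      pr R (fun f : {ffun 'I_m -> X} => is_hom F H (f \o phi)))).
    by apply: pr_union => f /existsP[phi hphi]; exists phi.
  apply: (@le_lt_trans _ _ (\sum_(phi : {ffun VF -> 'I_m}) z)).
    apply: ler_sum => phi _; rewrite leNgt; apply/negP => lt.
    have := @pr_hom_le R r VF X 'I_m F H X0 FH phi.
    rewrite card_ord => /(_ km); apply/negP; rewrite -ltNge.
    apply: (@lt_trans _ _ (z ^+ (2 ^ #|VF|))).
      by rewrite ltr_pdivrMr ?ltr0n // mulrC -ltr_pdivrMr ?exprn_gt0.
    by rewrite ltrXn2r ?expn_eq0 //; exact: ltW.
  rewrite sumr_const -[ltLHS]mulr_natl /z mulrCA gtr_pMr //.
  by rewrite ltr_pdivrMr // mul1r ltr_nat ltnSn.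
have prE : eps ^+ r <= pr R (fun f : {ffun 'I_m -> X} => J \in edges (blowup H f)).
  apply: le_trans (pr_edge R r0 H0 cJ).
  by rewrite lerXn2r ?nnegrE ?divr_ge0 // ltW.
have [f /and3P[Jf nB1 nB2]] : exists f : {ffun 'I_m -> X},
    [&& J \in edges (blowup H f), ~~ B1 f & ~~ B2 f].
  apply/existsP; apply: contraT; rewrite negb_exists => /forallP none.
  (* If no good map existed, an edge on [J] would always come with a bad event, giving
     [eps ^+ r <= 2/3 * eps ^+ r]. *)
  have : pr R (fun f : {ffun 'I_m -> X} => J \in edges (blowup H f)) <= pr R B1 + pr R B2.
    rewrite -(big_bool _ (fun b => pr R (if b then B1 else B2))); apply: pr_union => f Jf.
    by have := none f; rewrite Jf /= negb_and !negbK => /orP[? | ?]; [exists true|exists false].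
  lra.
exists (blowup H f); split=> [phi|].
  apply: contra nB2 => /is_hom_blowup hom; apply/existsP; by exists phi.
have m0 : 0 < m%:R :> R by rewrite ltr0n (leq_trans r0).
have G0 : (0 < #|edges (blowup H f)|)%N by apply/card_gt0P; exists J.
have [T pT le] := min_pos_codegree_attained r0 G0.
rewrite ler_pdivlMr //; apply: (@le_trans _ _ #|nbr (blowup H f) T|%:R); last by rewrite ler_nat.
rewrite leNgt; apply: contra nB1 => lt; apply/existsP; exists T.
by rewrite /low pT card_ord lt andbT; case/andP: pT => ->.
Qed.

(** * Passage to the limit *)

Local Open Scope classical_set_scope.
Local Open Scope ring_scope.

(** The infimum of the set [E] of eventual upper bounds is the limit superior. The hypothesis puts
    [a m + eps] in [E] for all large [m], so the limit inferior is no smaller. *)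
Lemma cvgn_of_eventually_le (R : realType) (a : R^nat) :
    (forall n, 0 <= a n <= 1) ->
    (forall eps : R, 0 < eps <= 1 -> exists m0, forall m, (m0 <= m)%N ->
      exists n0, forall n, (n0 <= n)%N -> a n - eps <= a m) ->
  cvgn a.
Proof.
move=> a01 ha.
pose E := [set y : R | exists n0, forall n, (n0 <= n)%N -> a n <= y].
have lbE : lbound E 0.
  by move=> y [n0 /(_ n0 (leqnn _))]; apply: le_trans; case/andP: (a01 n0).
have infE : has_inf E.
  by split; [exists 1, 0%N => n _; case/andP: (a01 n) | exists 0].
apply/cvg_ex; exists (inf E); apply/cvgrPdist_le => eps eps0.
pose e := Num.min eps 1.
have e0 : 0 < e by rewrite lt_min eps0 ltr01.
have ee : e <= eps by rewrite ge_min lexx.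
have [|m0 hm0] := ha e; first by rewrite e0 ge_min lexx orbT.
have [y [n0 hn0] ylt] := inf_adherent e0 infE.
near=> n.
have nm0 : (m0 <= n)%N by near: n; exact: nbhs_infty_ge.
have nn0 : (n0 <= n)%N by near: n; exact: nbhs_infty_ge.
have [n1 hn1] := hm0 n nm0.
have : inf E <= a n + e.
  by apply: (ge_inf infE.2); exists n1 => k /hn1; rewrite lerBlDr.
have := hn0 n nn0; rewrite ler_norml; lra.
Unshelve. all: by end_near.
Qed.

Theorem theorem22 (R : realType) (r : nat) (hr : (2 <= r)%N)
    (VF : finType) (F : hypergraph r VF) (hF : (0 < #|edges F|)%N) :
  cvgn (coex_ratio R F) /\
  forall eps : R, 0 < eps ->
    exists (V : finType) (H : hypergraph r V),
      [/\ (0 < #|V|)%N,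
          copy_free F H,
          (forall (W : finType) (p : W -> V), copy_free F (blowup H p)) &
          \forall n \near \oo,
            forall (W : finType) (p : W -> V), #|W| = n -> balanced_blowup p ->
              (min_pos_codegree (blowup H p))%:R / n%:R
                > gamma_plus R F - eps].
Proof.
have r0 : (0 < r)%N by apply: leq_trans hr.
have sample (eps : R) : 0 < eps <= 1 -> exists m0, forall m, (m0 <= m)%N ->
    exists n0, forall n, (n0 <= n)%N -> exists G : hypergraph r 'I_m,
      (forall phi : {ffun VF -> 'I_m}, ~~ is_hom F G phi) /\
      coex_ratio R F n - eps <= (min_pos_codegree G)%:R / m%:R.
  move=> eps01; have [m0 hm0] := exists_hom_free_sample r0 hF eps01.
  exists m0 => m /hm0[n0 hn0]; exists n0 => n nn0.
  have free0 : (0 < #|[pred H : hypergraph r 'I_n | copy_free F H]|)%N.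
    apply/card_gt0P; exists (empty_hypergraph r 'I_n).
    by apply: no_hom_copy_free => phi; apply: no_hom_empty.
  (* The sampling lemma is applied to an extremal [F]-free graph on [n] vertices. *)
  have [H FH maxH] := bigop.eq_bigmax_cond (fun H => min_pos_codegree H) free0.
  have := hn0 _ H _ FH; rewrite card_ord => /(_ nn0).
  by rewrite /coex_ratio /coex -maxH.
have cvg_a : cvgn (coex_ratio R F).
  apply: cvgn_of_eventually_le => [n|eps /sample[m0 hm0]].
    rewrite divr_ge0 //= /coex_ratio; have [->|n0] := posnP n; first by rewrite invr0 mulr0 ler01.
    rewrite ler_pdivrMr ?ltr0n // mul1r ler_nat; apply/bigmax_leqP => H _.
    by apply: leq_trans (min_pos_codegree_le_card H r0) _; rewrite card_ord.
  exists m0 => m /hm0[n0 hn0]; exists n0 => n /hn0[G [noG le]].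
  (* The sample is [F]-free on [m] vertices, so it competes in [coex F m]. *)
  apply: le_trans le _; rewrite ler_wpM2r ?invr_ge0 // ler_nat.
  exact: (bigop.bigmax_sup G) (no_hom_copy_free noG) _.
(* Three losses of at most [eps / 3] each: approximating the limit, sampling, and rounding class
   sizes. The cap at 1 is required by [sample]. *)
split=> // eps eps0; pose e := Num.min (eps / 3) 1.
have e0 : 0 < e by rewrite lt_min ltr01 divr_gt0.
have ee : e <= eps / 3 by rewrite ge_min lexx.
have [|m0 /(_ (maxn m0 1) (leq_maxl _ _))] := sample e; first by rewrite e0 ge_min lexx orbT.
have : (0 < maxn m0 1)%N by rewrite leq_max orbT.
move: (maxn m0 1) => m m_gt0 [n0 hn0].
have [n [/hn0[G [noG leG]] an]] : exists n, (n0 <= n)%N /\ gamma_plus R F - e <= coex_ratio R F n.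
  have /cvgrPdist_le/(_ e e0) [n1 _ hn1] := cvg_a.
  exists (maxn n0 n1); split; first exact: leq_maxl.
  have := hn1 (maxn n0 n1) (leq_maxr _ _); rewrite /= ler_norml /gamma_plus; lra.
exists 'I_m, G; split; first by rewrite card_ord.
- exact: no_hom_copy_free.
- exact: no_hom_blowup_free.
have mR : 0 < m%:R :> R by rewrite ltr0n.
near=> N => W p cW bal.
have Ne : m%:R / e < N%:R by near: N; exact: nbhs_infty_gtr.
have NR : 0 < N%:R :> R by apply: lt_trans Ne; rewrite divr_gt0.
have mN : m%:R / N%:R < e by rewrite ltr_pdivrMr // mulrC -ltr_pdivrMr.
(* Floor and ceiling alike are at least [N %/ m], so every class has that many vertices. *)
have lb : (N %/ m * min_pos_codegree G <= min_pos_codegree (blowup G p))%N.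
  apply: min_pos_codegree_blowup => // v; have := bal v; rewrite card_ord cW.
  by case=> ->; rewrite // leq_div2r // leq_addr.
have Gm : (min_pos_codegree G <= m)%N.
  by have := min_pos_codegree_le_card G r0; rewrite card_ord.
have divN : N%:R / m%:R - 1 <= (N %/ m)%:R :> R.
  by rewrite lerBlDr ler_pdivrMr // natr1 -natrM ler_nat ltnW // ltn_ceil.
(* Replacing [N / m] by its floor costs at most one copy of [min_pos_codegree G], hence at most [m],
   and [m / N < e]. *)
have : (min_pos_codegree G)%:R / m%:R - m%:R / N%:R
    <= (min_pos_codegree (blowup G p))%:R / N%:R :> R.
  rewrite ler_pdivlMr // mulrBl mulfVK ?gt_eqF //.
  apply: (@le_trans _ _ ((N %/ m)%:R * (min_pos_codegree G)%:R)); last by rewrite -natrM ler_nat.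
  apply: le_trans (ler_wpM2r _ divN) => //.
  by rewrite mulrBl mul1r mulrAC [in leRHS]mulrAC [_%:R * N%:R]mulrC lerB // ler_nat.
lra.
Unshelve. all: by end_near.
Qed.
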